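(* Let $K$ be a field of characteristic $0$ and $S=K[x_1,\dots,x_n]$. Let $I$ and $J$ be Borel-fixed ideals of $S$ and let $t\in\mathbb{N}$. Then $$\operatorname{reg} Z_t(I,S/J)\leq t(\operatorname{reg} I+1)+\operatorname{reg}(S/J).$$
   Context: A monomial ideal $I\subset S$ is Borel-fixed if $\varphi(I)=I$ for every invertible upper triangular matrix $\varphi=(a_{ij})\in \mathrm{GL}_n(K)$, acting on $S$ by $\varphi(f)(x_1,\dots,x_n)=f(\sum_k a_{k1}x_k,\dots,\sum_k a_{kn}x_k)$; in characteristic $0$ this is equivalent to: for every monomial $fx_j\in I$ and every $i<j$, $fx_i\in I$. Let $f_1,\dots,f_m$ be the minimal monomial generators of $I$, $F=\bigoplus_{i=1}^m S(-\deg f_i)$ with basis $e_1,\dots,e_m$ ($\deg e_i=\deg f_i$), and $\phi:F\to S$, $\phi(e_i)=f_i$. The Koszul complex is $K(I,S/J)=\bigwedge^\bullet F\otimes_S S/J$ with differential induced by $\phi$ (degree $0$), and $Z_t(I,S/J)$ is its graded module of cycles in homological position $t$. $\operatorname{reg}$ denotes Castelnuovo–Mumford regularity ($-\infty$ for the zero module). *)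

(* Defs.v *)
From HB Require Import structures.
From mathcomp Require Import all_boot all_order all_algebra.
From mathcomp Require Import mpoly.
Set Implicit Arguments. Unset Strict Implicit. Unset Printing Implicit Defensive.
Import Order.TTheory GRing.Theory Num.Theory.
Local Open Scope ring_scope.

Section Defs.
Variables (K : fieldType) (n : nat).
Local Notation S := {mpoly K[n]}.

Definition is_ideal (I : S -> Prop) : Prop :=
  [/\ I 0, (forall p q, I p -> I q -> I (p + q)) & (forall p q, I q -> I (p * q))].

Definition monomial_ideal (I : S -> Prop) : Prop :=
  is_ideal I /\
  forall p, I p -> exists s : seq (S * 'X_{1..n}),
      (forall x, x \in s -> I 'X_[x.2]) /\ p = \sum_(x <- s) x.1 * 'X_[x.2].

Definition mat_act (a : 'M[K]_n) (p : S) : S :=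
  p \mPo [tuple \sum_(k < n) a k j *: 'X_k | j < n].

Definition upper_triangular (a : 'M[K]_n) : Prop :=
  forall i j : 'I_n, (j < i)%N -> a i j = 0.

Definition borel_fixed (I : S -> Prop) : Prop :=
  monomial_ideal I /\
  forall a : 'M[K]_n, a \in unitmx -> upper_triangular a ->
    (forall p, I p -> I (mat_act a p)) /\
    (forall q, I q -> exists p, I p /\ mat_act a p = q).

Definition mdivides (m1 m2 : 'X_{1..n}) : Prop := forall i, (m1 i <= m2 i)%N.

Definition min_monomial_gens (I : S -> Prop) (gs : seq 'X_{1..n}) : Prop :=
  uniq gs /\
  forall m, m \in gs <-> (I 'X_[m] /\ forall m', I 'X_[m'] -> mdivides m' m -> m' = m).

(* p is homogeneous of degree e (e : int; for e < 0 this forces p = 0) *)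
Definition homog_int (e : int) (p : S) : Prop :=
  forall m, m \in msupp p -> (mdeg m)%:Z = e.

(* A graded S-module given as a subquotient U / (U :&: W) of the graded free
   module with basis indexed by iota, basis element k in degree shift k. *)
Record gmod := GMod {
  gm_idx : finType;
  gm_shift : gm_idx -> int;
  gm_U : (gm_idx -> S) -> Prop;
  gm_W : (gm_idx -> S) -> Prop }.

Definition hom_vec (M : gmod) (d : int) (v : gm_idx M -> S) : Prop :=
  forall k, homog_int (d - gm_shift k) (v k).

(* Koszul differential of K(x_1,...,x_n) tensor M, on coefficient families
   u : (subsets B of {1..n}) -> M, with d(e_B) = sum_{l in B} (-1)^{#{q in B | q<l}} x_l e_{B\l} *)
Definition kdiff (M : gmod) (u : {set 'I_n} -> gm_idx M -> S) (C : {set 'I_n})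
  : gm_idx M -> S :=
  fun k => \sum_(l : 'I_n | l \notin C)
     (-1) ^+ #|[set q in C | (q < l)%N]| * 'X_l * u (l |: C) k.

(* Tor_i(M,K)_j <> 0, computed as Koszul homology H_i(x_1..x_n; M)_j <> 0 *)
Definition tor_nz (M : gmod) (i : nat) (j : int) : Prop :=
  exists u : {set 'I_n} -> gm_idx M -> S,
    (forall B : {set 'I_n}, #|B| = i -> gm_U (u B) /\ hom_vec (j - i%:Z) (u B)) /\
    (forall C : {set 'I_n}, #|C|.+1 = i -> gm_W (kdiff u C)) /\
    ~ (exists w : {set 'I_n} -> gm_idx M -> S,
         (forall B : {set 'I_n}, #|B| = i.+1 -> gm_U (w B) /\ hom_vec (j - i.+1%:Z) (w B)) /\
         (forall B : {set 'I_n}, #|B| = i -> gm_W (fun k => u B k - kdiff w B k))).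

(* reg M <= a  (reg M = max { j - i : Tor_i(M,K)_j <> 0 }, -oo for M = 0) *)
Definition reg_le (M : gmod) (a : int) : Prop :=
  forall (i : nat) (j : int), tor_nz M i j -> j - i%:Z <= a.

Definition ideal_mod (I : S -> Prop) : gmod :=
  @GMod unit (fun _ => 0) (fun v => I (v tt)) (fun v => v tt = 0).

Definition quot_mod (J : S -> Prop) : gmod :=
  @GMod unit (fun _ => 0) (fun _ => True) (fun v => J (v tt)).

(* Z_t(I, S/J): cycles in homological position t of the Koszul complex
   wedge F (x) S/J, F with basis e_1..e_m, deg e_p = deg f_p, f_p = x^(gs_p). *)
Definition cycles_mod (gs : seq 'X_{1..n}) (J : S -> Prop) (t : nat) : gmod :=
  @GMod {set 'I_(size gs)}
    (fun A => (\sum_(p in A) mdeg (nth 0%MM gs p))%N%:Z)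
    (fun c => (forall A : {set 'I_(size gs)}, #|A| <> t -> c A = 0) /\
              (forall C : {set 'I_(size gs)}, #|C|.+1 = t ->
                 J (\sum_(p : 'I_(size gs) | p \notin C)
                      (-1) ^+ #|[set q in C | (q < p)%N]| * 'X_[nth 0%MM gs p]
                        * c (p |: C))))
    (fun c => forall A, J (c A)).

End Defs.

(* Main.v *)
Require Import Defs.
From HB Require Import structures.
From mathcomp Require Import all_boot all_order all_algebra.
From mathcomp Require Import mpoly.
From mathcomp Require Import zify ring.
From Stdlib Require Import FunctionalExtensionality Classical.
Set Implicit Arguments. Unset Strict Implicit. Unset Printing Implicit Defensive.
Import Order.TTheory GRing.Theory Num.Theory.
Local Open Scope ring_scope.

(* Induction on the number k of variables, with the variables x_k, x_(k+1), ...
   put into J, so that the generators of I they divide act as zero.  The cycle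
   module splits according to the set E of those dead generators occurring in
   e_A, and the inductive bound for the summand of E is t (a + 1) + b - |E|.
   To pass from k to k + 1 variables, put y = x_k.  In char. 0, Borel-fixed
   means strongly stable, hence J and J : y^oo differ only in degrees <= b, and
   replacing J by J : y^oo does not affect the bound.  Now y is regular on
   S/J, so it suffices to bound the cycles of K(I, S/J) reduced modulo y.  They
   sit inside the cycles of K(I, S/(J + y)), which are known by induction, and
   contain all of those of degree >= t (a + 1) + b - |E|: by the finer bound, a
   cycle with s more dead generators than E lies, in these degrees, in
   (x_0, ..., x_(k-1))^s times such cycles, and each x_l e_q with f_q divisible
   by y lifts to a syzygy x_l e_q - y u e_r because x_l f_q / y is in I. *)

(** * Koszul differential, exterior multiplication and contraction, with signs *)

Section KoszulOperators.
Variables (R : comNzRingType) (N : nat).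
Implicit Types (p q : 'I_N) (A B C : {set 'I_N}) (g : 'I_N -> R)
  (c : {set 'I_N} -> R).

Definition sgn p A : R := (-1) ^+ #|[set q in A | (q < p)%N]|.

(** The family [g] is arbitrary because the operator serves twice: with the generators f_p for K(I,
    S/J), and with the variables for the Koszul homology that computes Tor. *)
Definition kos g c C : R := \sum_(p | p \notin C) sgn p C * g p * c (p |: C).

(** Left exterior multiplication by e_q, read off on coefficients. *)
Definition wedge q c A : R := if q \in A then sgn q A * c (A :\ q) else 0.

(** Interior product with the dual of e_q. *)
Definition contract q c A : R := if q \in A then 0 else sgn q A * c (q |: A).

Lemma sgn_sq p A : sgn p A * sgn p A = 1.
Proof. by rewrite /sgn -expr2 sqrr_sign. Qed.

Lemma sgnU1 p q A : q \notin A ->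
  sgn p (q |: A) = if (q < p)%N then - sgn p A else sgn p A.
Proof.
move=> qA; rewrite /sgn; case: ltnP => qp.
  have -> : [set x in q |: A | (x < p)%N] = q |: [set x in A | (x < p)%N].
    by apply/setP=> x; rewrite !inE; case: eqP => [->|]; rewrite ?qp.
  by rewrite cardsU1 !inE (negbTE qA) /= add1n exprS mulN1r.
congr (_ ^+ _); apply: eq_card => x; rewrite !inE.
by case: eqP => [->|//]; rewrite ltnNge qp (negbTE qA).
Qed.

Lemma sgnU1_id p A : sgn p (p |: A) = sgn p A.
Proof.
congr (_ ^+ _); apply: eq_card => x; rewrite !inE.
by case: eqP => [->|//]; rewrite ltnn !andbF.
Qed.

Lemma sgnD1 p A : sgn p (A :\ p) = sgn p A.
Proof.
congr (_ ^+ _); apply: eq_card => x; rewrite !inE.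
by case: eqP => [->|//]; rewrite ltnn !andbF.
Qed.

Lemma sgn_swap p q C : p != q -> p \notin C -> q \notin C ->
  sgn p C * sgn q (p |: C) = - (sgn q C * sgn p (q |: C)).
Proof.
move=> pq pC qC; rewrite !sgnU1 //.
have : (p : nat) != q by [].
by case: ltngtP => // _ _; rewrite ?mulrN ?opprK mulrC.
Qed.

Lemma kosD g c1 c2 C : kos g (fun A => c1 A + c2 A) C = kos g c1 C + kos g c2 C.
Proof. by rewrite -big_split /=; apply: eq_bigr => p _; rewrite mulrDr. Qed.

Lemma kosN g c C : kos g (fun A => - c A) C = - kos g c C.
Proof. by rewrite -sumrN; apply: eq_bigr => p _; rewrite mulrN. Qed.

Lemma kosB g c1 c2 C : kos g (fun A => c1 A - c2 A) C = kos g c1 C - kos g c2 C.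
Proof. by rewrite kosD kosN. Qed.

Lemma kosM g r c C : kos g (fun A => r * c A) C = r * kos g c C.
Proof. by rewrite mulr_sumr; apply: eq_bigr => p _; rewrite mulrCA. Qed.

(** The double sum runs over ordered pairs p != q, and the terms of (p, q) and (q, p) cancel by
    [sgn_swap]. *)
Lemma kos_kos g c C : kos g (kos g c) C = 0.
Proof.
pose t p q := sgn p C * g p * (sgn q (p |: C) * g q * c (q |: (p |: C))).
have -> : kos g (kos g c) C =
    \sum_(p | p \notin C) \sum_(q | (q \notin C) && (p != q)) t p q.
  apply: eq_bigr => p pC; rewrite mulr_sumr; apply: eq_bigl => q.
  by rewrite in_setU1 negb_or andbC eq_sym.
have tE p q : p \notin C -> q \notin C -> p != q -> t p q = - t q p.
  move=> pC qC pq; rewrite /t setUCA.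
  transitivity (sgn p C * sgn q (p |: C) * (g p * g q * c (p |: (q |: C)))); first by ring.
  by rewrite sgn_swap //; ring.
rewrite pair_big_dep /= (bigID (fun x : 'I_N * 'I_N => (x.1 < x.2)%N)) /=.
rewrite [X in _ + X](reindex_inj (h := fun x : 'I_N * 'I_N => (x.2, x.1))); last first.
  by move=> [x1 x2] [y1 y2] [-> ->].
rewrite [X in _ + X](eq_big (fun x : 'I_N * 'I_N => [&& x.1 \notin C, (x.2 \notin C) &&
   (x.1 != x.2) & (x.1 < x.2)%N]) (fun x => - t x.1 x.2)) /=.
- rewrite sumrN; apply/eqP; rewrite subr_eq0; apply/eqP.
  by apply: eq_bigl => x; rewrite -!andbA.
- move=> [x y] /=; rewrite [y == x]eq_sym -leqNgt leq_eqVlt.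
  case: (x \notin C); case: (y \notin C) => //=.
  by case: (eqVneq x y) => //= /negbTE xy; rewrite -val_eqE /= in xy; rewrite xy.
- by move=> [x y] /= /andP [/and3P [yC xC xy] _]; rewrite tE // 1?eq_sym.
Qed.

(** Leibniz rule for e_q and c, where e_q maps to g_q. *)
Lemma kos_wedge g q c C : kos g (wedge q c) C = g q * c C - wedge q (kos g c) C.
Proof.
rewrite /kos /wedge; case: (boolP (q \in C)) => qC; last first.
  rewrite subr0 (bigD1 q) //= setU11 sgnU1_id setU1K //.
  rewrite big1 ?addr0 ?[_ * g q]mulrC.
    by rewrite -mulrA [sgn q C * _]mulrA sgn_sq mul1r.
  by move=> p /andP [pC pq]; rewrite in_setU1 (negbTE qC) eq_sym (negbTE pq) mulr0.
rewrite [in RHS](bigD1 q) /=; last by rewrite !inE eqxx.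
rewrite setD1K // sgnD1 mulrDr -!mulrA [sgn q C * (sgn q C * _)]mulrA sgn_sq mul1r.
rewrite opprD addrA subrr add0r mulr_sumr -sumrN.
apply: eq_big => [p|p pC]; first by rewrite !inE; case: (eqVneq p q) => [->|];
  rewrite ?qC ?andbF ?andbT.
have pq : p != q by apply: contraNneq pC => ->.
rewrite in_setU1 qC orbT.
have -> : (p |: C) :\ q = p |: (C :\ q).
  by apply/setP=> x; rewrite !inE; case: (eqVneq x p) => [->|//]; rewrite pq.
have pCq : p \notin C :\ q by rewrite !inE (negbTE pC) andbF.
have qCq : q \notin C :\ q by rewrite !inE eqxx.
have sw : sgn p C * sgn q (p |: C) = - (sgn q C * sgn p (C :\ q)).
  have -> : sgn q (p |: C) = sgn q (p |: (C :\ q)).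
    by rewrite -[LHS]sgnD1; congr sgn; apply/setP=> x; rewrite !inE;
      case: (eqVneq x p) => [->|//]; rewrite pq.
  rewrite -[in sgn p C](setD1K qC) !sgnU1 // sgnD1.
  have : (p : nat) != q by [].
  by case: ltngtP => // _ _; rewrite ?mulrN ?mulNr mulrC.
transitivity (sgn p C * sgn q (p |: C) * (g p * c (p |: (C :\ q)))).
  by ring.
by rewrite sw; ring.
Qed.

(** Contraction anticommutes with the differential; hence it sends cycles to cycles. *)
Lemma kos_contract g q c C :
  kos g (contract q c) C = if q \in C then 0 else - (sgn q C * kos g c (q |: C)).
Proof.
rewrite /kos /contract; case: (boolP (q \in C)) => qC.
  by rewrite big1 // => p _; rewrite in_setU1 qC orbT mulr0.
rewrite (bigD1 q) //= setU11 mulr0 add0r mulr_sumr -sumrN.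
apply: eq_big => [p|p /andP [pC pq]]; first by rewrite in_setU1 negb_or andbC.
rewrite in_setU1 (negbTE qC) eq_sym (negbTE pq) /= setUCA.
transitivity (sgn p C * sgn q (p |: C) * (g p * c (p |: (q |: C)))).
  by ring.
by rewrite sgn_swap //; ring.
Qed.

Lemma wedge_contract q c A : (c A != 0 -> q \in A) ->
  wedge q (contract q c) A = c A.
Proof.
rewrite /wedge /contract; case: (boolP (q \in A)) => qA.
  by rewrite !inE eqxx /= setD1K // sgnD1 mulrA sgn_sq mul1r.
by move=> h; apply/eqP; rewrite eq_sym; apply: contraTT isT => /h.
Qed.

End KoszulOperators.

(** * Homogeneous polynomials of integer degree and closure of ideals *)

Section Homogeneous.
Variables (K : fieldType) (n : nat).
Local Notation S := {mpoly K[n]}.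
Implicit Types (p q : S) (e : int) (J : S -> Prop).

Lemma homog_int0 e : homog_int e (0 : S).
Proof. by move=> m; rewrite msupp0. Qed.

Lemma homog_intD e p q : homog_int e p -> homog_int e q -> homog_int e (p + q).
Proof. by move=> hp hq m /msuppD_le; rewrite mem_cat => /orP [/hp|/hq]. Qed.

Lemma homog_intN e p : homog_int e p -> homog_int e (- p).
Proof. by move=> hp m; rewrite (perm_mem (msuppN p)) => /hp. Qed.

Lemma homog_intB e p q : homog_int e p -> homog_int e q -> homog_int e (p - q).
Proof. by move=> hp hq; apply: homog_intD => //; apply: homog_intN. Qed.

Lemma homog_intM e1 e2 p q :
  homog_int e1 p -> homog_int e2 q -> homog_int (e1 + e2) (p * q).
Proof.
move=> hp hq m /msuppM_le /allpairsP [[m1 m2] /= [/hp <- /hq <- ->]].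
by rewrite mdegD PoszD.
Qed.

Lemma homog_intX m : homog_int (mdeg m)%:Z ('X_[m] : S).
Proof. by move=> m'; rewrite msuppX inE => /eqP ->. Qed.

Lemma homog_int1 : homog_int 0 (1 : S).
Proof. by rewrite -mpolyX0 -[0]/(0%N%:Z) -(@mdeg0 n); apply: homog_intX. Qed.

Lemma homog_int_sgn N (p : 'I_N) A : homog_int 0 (sgn S p A).
Proof.
rewrite /sgn; elim: #|_| => [|k IH]; first by rewrite expr0; apply: homog_int1.
by rewrite exprS mulN1r; apply: homog_intN.
Qed.

Lemma homog_int_sum e (I : Type) (r : seq I) (P : pred I) (F : I -> S) :
  (forall i, P i -> homog_int e (F i)) -> homog_int e (\sum_(i <- r | P i) F i).
Proof.
move=> hF; elim/big_rec: _ => [|i p Pi hp]; first exact: homog_int0.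
by apply: homog_intD => //; apply: hF.
Qed.

Lemma ideal_sum J (I : Type) (r : seq I) (P : pred I) (F : I -> S) : is_ideal J ->
  (forall i, P i -> J (F i)) -> J (\sum_(i <- r | P i) F i).
Proof. by case=> J0 JD _ hF; elim/big_rec: _ => [|i p Pi hp]; auto. Qed.

Lemma idealN J p : is_ideal J -> J p -> J (- p).
Proof. by case=> _ _ JM Jp; rewrite -mulN1r; apply: JM. Qed.

Lemma idealB J p q : is_ideal J -> J p -> J q -> J (p - q).
Proof. by move=> iJ Jp Jq; case: (iJ) => _ JD _; apply: JD => //; apply: idealN. Qed.

Lemma ideal_kos J N (g : 'I_N -> S) c C : is_ideal J ->
  (forall A, J (c A)) -> J (kos g c C).
Proof. by move=> iJ Jc; apply: ideal_sum => // p _; case: iJ => _ _; apply. Qed.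

End Homogeneous.

(** * Regularity of subquotients through Koszul homology of the first k variables *)

Section Regularity.
Variables (K : fieldType) (n : nat) (T : Type) (sh : T -> int).
Local Notation S := {mpoly K[n]}.
Implicit Types (U : (T -> S) -> Prop) (J : S -> Prop) (d e : int) (k : nat)
  (u w : {set 'I_n} -> T -> S).

Definition homv e (v : T -> S) : Prop := forall a, homog_int (e - sh a) (v a).

(** Variables of index at least k are replaced by 0 instead of being dropped, so that chains are
    indexed by subsets of ['I_n] for every k. *)
Definition kvar k (l : 'I_n) : S := if (l < k)%N then 'X_l else 0.

Definition kd k u C (a : T) : S := kos (kvar k) (u^~ a) C.

Definition submod U : Prop := [/\ U (fun=> 0),
  (forall v v', U v -> U v' -> U (fun a => v a + v' a)) &
  (forall p v, U v -> U (fun a => p * v a))].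

Lemma submod_sum U (I : Type) (r : seq I) (P : pred I) (F : I -> T -> S) :
  submod U -> (forall i, P i -> U (F i)) -> U (fun a => \sum_(i <- r | P i) F i a).
Proof.
case=> U0 UD _ UF; elim: r => [|i r IH].
  by rewrite (_ : (fun a => _) = fun=> 0) //; extensionality a; rewrite big_nil.
rewrite (_ : (fun a => _) = fun a => (if P i then F i a else 0) +
    \sum_(j <- r | P j) F j a).
  by apply: (UD (fun a => if P i then F i a else 0)) => //; case Pi: (P i); [apply: UF|].
by extensionality a; rewrite big_cons; case: ifP; rewrite ?add0r.
Qed.

Lemma submodB U v v' : submod U -> U v -> U v' -> U (fun a => v a - v' a).
Proof.
case=> _ UD UM Uv Uv'; apply: UD => //.
rewrite (_ : (fun a => - v' a) = fun a => -1 * v' a); first exact: UM.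
by extensionality a; rewrite mulN1r.
Qed.

(* Koszul homology of x_0, ..., x_(k-1) on U / (U :&: J^T) vanishes in degrees
   j - i > d; all homological positions i are treated at once, as a chain is
   homogeneous of internal degree j - i in every position. *)
Definition regk k U J d : Prop := forall e u, d < e ->
  (forall B, U (u B)) -> (forall B, homv e (u B)) ->
  (forall C a, J (kd k u C a)) ->
  exists w, forall B, [/\ U (w B), homv (e - 1) (w B) &
                          forall a, J (u B a - kd k w B a)].

Lemma kdB k u w C a : kd k (fun B a => u B a - w B a) C a = kd k u C a - kd k w C a.
Proof. exact: kosB. Qed.

Lemma kd_kd k u C a : kd k (kd k u) C a = 0.
Proof. exact: kos_kos. Qed.

Lemma submod_kd U k u C : submod U -> (forall B, U (u B)) -> U (kd k u C).
Proof. by move=> sU Uu; apply: submod_sum => // l _; case: sU => _ _; apply. Qed.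

Lemma hom_kd k e u C : (forall B, homv (e - 1) (u B)) -> homv e (kd k u C).
Proof.
move=> hu a; apply: homog_int_sum => l _; rewrite /kvar.
case: ifP => _; last by rewrite mulr0 mul0r; apply: homog_int0.
have -> : e - sh a = (0 + (mdeg U_(l))%:Z) + (e - 1 - sh a) by rewrite mdeg1; lia.
apply: homog_intM; last exact: hu.
by apply: homog_intM; [apply: homog_int_sgn | apply: homog_intX].
Qed.

(** A cycle over U is bounded in U'/J', and the bounding chain is then moved back into U. That chain
    has degree e - 1, which may equal d; this is why lifting is required from degree d on, the other
    comparisons only above d. *)
Lemma regk_transfer k U J U' J' d : is_ideal J' -> submod U ->
  (forall e v, d < e -> homv e v -> U v -> U' v) ->
  (forall e p, d < e -> homv e p -> (forall a, J (p a)) -> forall a, J' (p a)) ->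
  (forall e p, d < e -> homv e p -> U p -> (forall a, J' (p a)) ->
     forall a, J (p a)) ->
  (forall e v, d <= e -> homv e v -> U' v ->
     exists v', [/\ U v', homv e v' & forall a, J' (v a - v' a)]) ->
  regk k U' J' d -> regk k U J d.
Proof.
move=> iJ' sU UU' JJ' J'J lift reg e u de Uu hu Ju.
have hom1 B : homv (e + 1 - 1) (u B) by rewrite addrK.
have [w Hw] : exists w, forall B, [/\ U' (w B), homv (e - 1) (w B) &
                          forall a, J' (u B a - kd k w B a)].
  apply: reg => // [B|C]; first exact: UU' de (hu B) (Uu B).
  apply: (JJ' (e + 1)); [lia | exact: hom_kd | exact: Ju].
have /fin_all_exists [v Hv] B : exists v', [/\ U v', homv (e - 1) v' &
    forall a, J' (w B a - v' a)].
  by case: (Hw B) => U'w hw _; apply: lift => //; lia.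
exists v => B; case: (Hw B) => _ hw J'w; case: (Hv B) => Uv hv J'v; split=> //.
apply: (J'J e) => //.
- by move=> a; apply: homog_intB; [apply: hu | apply: hom_kd => B'; case: (Hv B')].
- by apply: submodB => //; apply: submod_kd => // B'; case: (Hv B').
move=> a; have -> : u B a - kd k v B a =
    (u B a - kd k w B a) + kd k (fun B a => w B a - v B a) B a by rewrite kdB; ring.
case: (iJ') => _ JD _; apply: JD => //.
by apply: ideal_kos => // B'; case: (Hv B').
Qed.

Lemma kdS k (y : 'I_n) u C a : y = k :> nat -> kd k.+1 u C a =
  kd k u C a + (if y \in C then 0 else sgn S y C * 'X_y * u (y |: C) a).
Proof.
move=> yk; rewrite /kd /kos; case: (boolP (y \in C)) => yC.
  rewrite addr0; apply: eq_bigr => l lC; rewrite /kvar ltnS leq_eqVlt -yk.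
  by case: eqP => [/val_inj ly|//]; rewrite ly yC in lC.
rewrite (bigD1 y) //= [in RHS](bigD1 y) //= {1 3}/kvar yk ltnS leqnn ltnn.
rewrite mulr0 mul0r add0r addrC; congr (_ + _).
apply: eq_bigr => l /andP [lC ly]; rewrite /kvar ltnS leq_eqVlt -yk.
by rewrite -val_eqE in ly; rewrite (negbTE ly).
Qed.

(** For y regular on S/J and U compatible with division by y, homology of x_0, ..., x_k on U modulo
    J is homology of x_0, ..., x_(k-1) on U modulo J + (y). *)
Lemma regk_nonzerodivisor k (y : 'I_n) U J Jy d : y = k :> nat ->
  is_ideal J -> is_ideal Jy -> submod U ->
  (forall p, J ('X_y * p) -> J p) -> (forall p, J p -> Jy p) ->
  (forall p, Jy ('X_y * p)) ->
  (forall e v, homv e v -> U v -> (forall a, Jy (v a)) ->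
    exists v', [/\ U v', homv (e - 1) v' & forall a, J (v a - 'X_y * v' a)]) ->
  regk k U Jy d -> regk k.+1 U J d.
Proof.
move=> yk iJ iJy sU nzd JJy Jyy lift reg e u de Uu hu Ju.
have [U0 _ UM] := sU; have [_ JD JM] := iJ; have [_ JyD JyM] := iJy.
(* The part of the chain without e_y is a cycle for the first k variables modulo [Jy]. *)
pose u0 (B : {set 'I_n}) a := if y \in B then 0 else u B a.
have kd0 (v : {set 'I_n} -> T -> S) C a :
    kd k (fun (B : {set 'I_n}) a => if y \in B then 0 else v B a) C a =
    if y \in C then 0 else kd k v C a.
  rewrite /kd /kos; case: ifP => yC.
    by apply: big1 => l _; rewrite in_setU1 yC orbT mulr0.
  apply: eq_bigr => l _; rewrite in_setU1 yC orbF.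
  by case: eqP => // <-; rewrite /kvar yk ltnn !(mulr0, mul0r).
have [w0 Hw0] : exists w, forall B, [/\ U (w B), homv (e - 1) (w B) &
                          forall a, Jy (u0 B a - kd k w B a)].
  apply: reg => // [B|B|C a].
  - by rewrite /u0; case: (y \in B).
  - by rewrite /u0 => a; case: (y \in B); [apply: homog_int0 | apply: hu].
  rewrite kd0; case: ifP => yC; first by case: iJy.
  have -> : kd k u C a = kd k.+1 u C a - 'X_y * (sgn S y C * u (y |: C) a).
    by rewrite (kdS _ _ _ yk) yC; ring.
  by apply: idealB => //; apply: JJy.
have /fin_all_exists [v Hv] (B : {set 'I_n}) : exists v', y \notin B ->
    [/\ U v', homv (e - 1) v' &
    forall a, J (u B a - kd k w0 B a - 'X_y * v' a)].
  case: (boolP (y \in B)) => yB; first by exists (fun=> 0).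
  case: (Hw0 B) => Uw hw Jw.
  have [||a|v' [Uv' hv' Jv']] := lift e (fun a => u B a - kd k w0 B a).
  - by move=> a; apply: homog_intB; [apply: hu | apply: hom_kd => B'; case: (Hw0 B')].
  - by apply: submodB => //; apply: submod_kd => // B'; case: (Hw0 B').
  - by have := Jw a; rewrite /u0 (negbTE yB).
  by exists v'.
(* What [w0] fails to bound is y v modulo J, and the term v e_y of [w] produces exactly this. *)
pose w (B : {set 'I_n}) a := if y \in B then sgn S y B * v (B :\ y) a else w0 B a.
have Uw B : U (w B).
  rewrite /w; case: (boolP (y \in B)) => yB; last by case: (Hw0 B).
  by apply: UM; case: (Hv (B :\ y)); rewrite // !inE eqxx.
have hw B : homv (e - 1) (w B).
  rewrite /w => a; case: (boolP (y \in B)) => yB; last by case: (Hw0 B).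
  rewrite -[e - 1 - sh a]add0r; apply: homog_intM; first exact: homog_int_sgn.
  by case: (Hv (B :\ y)); rewrite // !inE eqxx.
exists w; suff JyB (B : {set 'I_n}) a : y \notin B -> J (u B a - kd k.+1 w B a).
  move=> B; split=> // a; case: (boolP (y \in B)) => yB; last exact: JyB.
  (* The remainder [r] is a cycle modulo J. Its part without e_y lies in J, so y times the other
     coefficients lies in J too, and y is regular. *)
  pose r (B : {set 'I_n}) a := u B a - kd k.+1 w B a.
  rewrite -/(r B a); have yBy : y \notin B :\ y by rewrite !inE eqxx.
  have /= := kdS r (B :\ y) a yk; rewrite (negbTE yBy) setD1K // kdB kd_kd subr0.
  move=> E; apply: nzd; rewrite -[X in J X]mul1r -(sgn_sq _ y (B :\ y)).
  rewrite -mulrA; apply: (JM); rewrite mulrA.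
  have -> : sgn S y (B :\ y) * 'X_y * r B a = kd k.+1 u (B :\ y) a - kd k r (B :\ y) a.
    by rewrite E addrC addKr.
  apply: idealB => //; apply: ideal_sum => // l lB.
  rewrite /kvar; case: ifP => lk; last by rewrite mulr0 mul0r; case: iJ.
  apply: (JM); apply: JyB; rewrite in_setU1 negb_or yBy andbT.
  by apply: contraTneq lk => <-; rewrite yk ltnn.
move=> yB; rewrite (kdS _ _ _ yk) (negbTE yB).
have -> : kd k w B a = kd k w0 B a.
  apply: eq_bigr => l lB; rewrite /kvar; case: ifP => lk; last by rewrite mulr0 !mul0r.
  rewrite /w in_setU1 (negbTE yB) orbF; case: eqP => // yl.
  by rewrite -yl yk ltnn in lk.
rewrite /w setU11 sgnU1_id setU1K //.
have -> : sgn S y B * 'X_y * (sgn S y B * v B a) = 'X_y * v B a.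
  by rewrite mulrACA [_ * v B a]mulrC mulrCA -{2}['X_y]mul1r -(sgn_sq _ y B); ring.
by rewrite opprD addrA; case: (Hv B yB).
Qed.

(** Position 0 of the homology: c placed at the empty set is a cycle, and a chain bounding it writes
    c as a combination of the variables. *)
Lemma regk_generation k U J d e c : is_ideal J -> submod U -> regk k U J d -> d < e ->
  U c -> homv e c -> exists x : 'I_n -> T -> S,
  [/\ forall l, U (x l), forall l, homv (e - 1) (x l) &
      forall a, J (c a - \sum_(l < n | (l < k)%N) 'X_l * x l a)].
Proof.
move=> iJ [U0 _ _] reg de Uc hc.
have [||C a|w Hw] := reg e (fun B => if B == set0 then c else fun=> 0) de.
- by move=> B; case: ifP.
- by move=> B a; case: ifP => _; [apply: hc | apply: homog_int0].
- rewrite /kd /kos big1 => [|l lC]; first by case: iJ.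
  case: eqP => [/setP/(_ l)|_]; last by rewrite mulr0.
  by rewrite !inE eqxx.
exists (fun l => w [set l]); split=> [l|l|a]; try by case: (Hw [set l]).
case: (Hw set0) => _ _ /(_ a); rewrite eqxx; congr (J (_ - _)).
rewrite /kd /kos big_mkcond [RHS]big_mkcond; apply: eq_bigr => l _.
rewrite inE /= setU0 /kvar; case: ifP => _; last by rewrite mulr0 mul0r.
rewrite /sgn (_ : [set q in set0 | _] = set0) ?cards0 ?mul1r //.
by apply/setP=> q; rewrite !inE.
Qed.

End Regularity.

(** * Monomial ideals, strong stability and saturation by a variable *)

Section MonomialIdeals.
Variables (K : fieldType) (n : nat).
Local Notation S := {mpoly K[n]}.
Implicit Types (P : 'X_{1..n} -> Prop) (m g : 'X_{1..n}) (y : 'I_n) (p : S).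

(** The ideal is encoded by the set P of its monomials, so that membership becomes a condition on
    exponents. *)
Definition mon_ideal P p : Prop := forall m, m \in msupp p -> P m.

Definition upward P : Prop := forall m m', P m -> P (m + m')%MM.

Lemma upward_le P m m' : upward P -> (m <= m')%MM -> P m -> P m'.
Proof. by move=> uP le; rewrite -(submK le) addmC; apply: uP. Qed.

Lemma is_ideal_mon P : upward P -> is_ideal (mon_ideal P).
Proof.
move=> uP; split=> [m|p q Pp Pq m|p q Pq m]; first by rewrite msupp0.
  by move/msuppD_le; rewrite mem_cat => /orP [/Pp|/Pq].
by move/msuppM_le/allpairsP=> [[m1 m2] /= [_ /Pq P2 ->]]; rewrite addmC; apply: uP.
Qed.

Lemma mon_idealX P m : P m -> mon_ideal P 'X_[m].
Proof. by move=> Pm m'; rewrite msuppX inE => /eqP ->. Qed.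

Lemma mon_ideal_nonzerodivisor P y p : (forall m, P (U_(y) + m)%MM -> P m) ->
  mon_ideal P ('X_y * p) -> mon_ideal P p.
Proof.
move=> h Pp m mp; apply: h; apply: Pp.
by rewrite mcoeff_msupp mulrC mcoeffMX -mcoeff_msupp.
Qed.

(** Division by y: r collects the terms free of y. Supports are tracked because homogeneity and
    membership in monomial ideals are read off from them. *)
Lemma mpoly_split y p : exists r v : S, [/\ p = r + 'X_y * v,
  forall m, m \in msupp r -> m \in msupp p /\ m y = 0%N &
  forall m, m \in msupp v -> (U_(y) + m)%MM \in msupp p].
Proof.
exists (\sum_(m <- msupp p | m y == 0%N) p@_m *: 'X_[m]).
exists (\sum_(m <- msupp p | m y != 0%N) p@_m *: 'X_[m - U_(y)]); split.
- rewrite {1}[p]mpolyE (bigID (fun m : 'X_{1..n} => m y == 0%N)) /=; congr (_ + _).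
  rewrite mulr_sumr; apply: eq_bigr => m my; rewrite -scalerAr -mpolyXD addmC submK //.
  by rewrite lep1mP.
- move=> m /msupp_sum_le /flattenP [s /mapP [m']].
  rewrite mem_filter => /andP [/eqP my mp] -> /msuppZ_le.
  by rewrite msuppX inE => /eqP ->.
- move=> m /msupp_sum_le /flattenP [s /mapP [m']].
  rewrite mem_filter => /andP [my mp] -> /msuppZ_le.
  by rewrite msuppX inE => /eqP ->; rewrite addmC submK // lep1mP.
Qed.

Lemma mpoly_split_fam (T : finType) y (c : T -> S) : exists r v : T -> S, [/\
  forall A, c A = r A + 'X_y * v A,
  forall A m, m \in msupp (r A) -> m \in msupp (c A) /\ m y = 0%N &
  forall A m, m \in msupp (v A) -> (U_(y) + m)%MM \in msupp (c A)].
Proof.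
have /fin_all_exists [r /fin_all_exists [v H]] A := mpoly_split y (c A).
by exists r, v; split=> A; case: (H A).
Qed.

(* The image in K[x_0, ..., x_(k-1)] of a strongly stable ideal generated in
   degrees <= b + 1, the other variables being put into P. *)
Definition stable_in k (b : int) P : Prop := [/\ upward P,
  (forall l : 'I_n, (k <= l)%N -> P U_(l)%MM),
  (forall m (i j : 'I_n), (i < j)%N -> (j < k)%N ->
     P (U_(j) + m)%MM -> P (U_(i) + m)%MM) &
  (forall m, P m -> (forall l : 'I_n, (k <= l)%N -> m l = 0%N) ->
     exists g, [/\ P g, (g <= m)%MM & (mdeg g)%:Z <= b + 1])].

(** The monomials of J : y^oo. *)
Definition saturation y P m : Prop := exists N, P (m + U_(y) *+ N)%MM.

Lemma saturationW y P m : P m -> saturation y P m.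
Proof. by exists 0%N; rewrite mulm0n addm0. Qed.

Lemma saturation_nonzerodivisor y P m :
  saturation y P (U_(y) + m)%MM -> saturation y P m.
Proof. by case=> N PN; exists N.+1; rewrite mulmS addmA [(m + _)%MM]addmC. Qed.

Lemma stable_in_saturation k b y P : y = k :> nat ->
  stable_in k.+1 b P -> stable_in k.+1 b (saturation y P).
Proof.
move=> yk [uP vP sP gP]; split.
- by move=> m m' [N PN]; exists N; rewrite -addmA [(m' + _)%MM]addmC addmA; apply: uP.
- by move=> l /vP; apply: saturationW.
- by move=> m i j ij jk [N PN]; exists N; rewrite -addmA; apply: (sP _ i j);
    rewrite // addmA.
move=> m [N PN] hm; have [|g [Pg gm gb]] := gP _ PN.
  move=> l kl; rewrite mnmDE hm // mulmnE mnm1E.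
  by case: eqP kl => [<-|_ _]; rewrite ?yk ?ltnn // muln0.
have gm' l : l != y -> (g l <= m l)%N.
  move=> ly; have /mnm_lepP/(_ l) := gm; rewrite mnmDE mulmnE mnm1E eq_sym (negbTE ly).
  by rewrite mul0n addn0.
(* Only the exponent of y in g can exceed that of m; cutting it down keeps the generator in the
   saturation and does not raise its degree. *)
exists [multinom minn (g l) (m l) | l < n]; split.
- exists (g y - m y)%N; rewrite (_ : (_ + _)%MM = g) //.
  apply/mnmP=> l; rewrite mnmDE mnmE mulmnE mnm1E; case: (eqVneq y l) => [<-|yl]; first lia.
  by have := gm' l; rewrite eq_sym yl; lia.
- by apply/mnm_lepP=> l; rewrite mnmE geq_minr.
- apply: le_trans gb; rewrite lez_nat !mdegE; apply: leq_sum => l _.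
  by rewrite mnmE geq_minl.
Qed.

(** An exchange among variables of index below k cannot lower the exponent of y, and a monomial free
    of y in the new ideal lies in P, so generators of P still serve. *)
Lemma stable_in_hyperplane k b y P : y = k :> nat ->
  stable_in k.+1 b P -> stable_in k b (fun m => P m \/ (0 < m y)%N).
Proof.
move=> yk [uP vP sP gP]; split.
- by move=> m m' [/uP|my]; [left | right; rewrite mnmDE ltn_addr].
- move=> l; rewrite leq_eqVlt => /orP [/eqP kl|/vP]; last by left.
  by right; rewrite (_ : y = l) ?mnm1E ?eqxx //; apply: val_inj; rewrite /= yk.
- move=> m i j ij jk [Pm|my]; first by left; apply: (sP _ i j) => //; lia.
  right; move: my; rewrite !mnmDE [(U_(j))%MM y]mnm1E.
  by case: eqP => [jy|_ /ltn_addl]; [rewrite jy yk ltnn in jk | apply].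
move=> m [Pm|my] hm; last by rewrite hm ?yk in my.
have [|g [Pg gm gb]] := gP m Pm; first by move=> l /ltnW; apply: hm.
by exists g; split=> //; left.
Qed.

(** Surplus factors y of g are traded one by one for variables in which m exceeds g. Such variables
    come before y, since m has no variable after y, so strong stability allows the trade; the end
    result divides m. *)
Lemma stable_in_exchange k b y P m g : y = k :> nat -> stable_in k.+1 b P ->
  P g -> (forall l : 'I_n, (k < l)%N -> m l = 0%N) ->
  (forall l, l != y -> (g l <= m l)%N) -> (mdeg g <= mdeg m)%N -> P m.
Proof.
move=> yk [uP vP sP gP] Pg hm; move Es: (g y - m y)%N => s.
elim: s g Pg Es => [|s IH] g Pg Es gm dg.
  apply: (upward_le uP) Pg; apply/mnm_lepP=> l.
  by case: (eqVneq l y) => [->|/gm //]; rewrite -subn_eq0 Es.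
(* Otherwise g would be at least m in every exponent and larger in that of y, against the
   degrees. *)
have [l /andP [ly gml]] : exists l, (l != y) && (g l < m l)%N.
  apply/existsP; apply: contraLR dg; rewrite negb_exists -ltnNge => /forallP h.
  rewrite !mdegE (bigD1 y) //= [X in (_ < X)%N](bigD1 y) //= -addSn.
  apply: leq_add; first lia.
  by apply: leq_sum => l ly; have := h l; rewrite ly /= -leqNgt.
have gy : (U_(y) <= g)%MM by rewrite lep1mP; apply/eqP; lia.
apply: (IH (U_(l) + (g - U_(y)))%MM).
- apply: (sP _ l y); last by rewrite addmC submK.
    case: (ltngtP l y) => // [yl|/val_inj E]; last by rewrite E eqxx in ly.
    by rewrite hm // -yk in gml.
  by rewrite yk.
- by rewrite mnmDE mnmBE !mnm1E (negbTE ly) eqxx; lia.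
- move=> l' l'y; rewrite mnmDE mnmBE !mnm1E [y == l']eq_sym (negbTE l'y) subn0.
  by case: eqP => [<-|_]; rewrite ?add0n ?gm.
- have := congr1 (@mdeg n) (submK gy); rewrite !mdegD !mdeg1; lia.
Qed.

(** A generator g dividing m y^N has degree at most b + 1, hence at most deg m, and exceeds m only
    in y; the exchange then puts m itself in P. *)
Lemma saturation_high_degree k b y P m : y = k :> nat -> stable_in k.+1 b P ->
  b < (mdeg m)%:Z -> saturation y P m -> P m.
Proof.
move=> yk stP bm [N PN]; have [uP vP _ gP] := stP.
case: (boolP [exists l : 'I_n, (k < l)%N && (m l != 0%N)]) => [/existsP[l /andP[kl ml]]|].
  by apply: (upward_le uP) (vP l kl); rewrite lep1mP.
rewrite negb_exists => /forallP hm.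
have {}hm (l : 'I_n) : (k < l)%N -> m l = 0%N.
  by move=> kl; have := hm l; rewrite kl /= negbK => /eqP.
have [|g [Pg gm gb]] := gP _ PN.
  move=> l kl; rewrite mnmDE hm // mulmnE mnm1E.
  by case: eqP kl => [<-|_ _]; rewrite ?yk ?ltnn // muln0.
apply: (stable_in_exchange yk stP Pg hm); last by rewrite -lez_nat; lia.
move=> l ly; have /mnm_lepP/(_ l) := gm; rewrite mnmDE mulmnE mnm1E eq_sym (negbTE ly).
by rewrite mul0n addn0.
Qed.

Lemma homog_int_split_rem e y (p r : S) :
  (forall m, m \in msupp r -> m \in msupp p /\ m y = 0%N) -> homog_int e p -> homog_int e r.
Proof. by move=> rp hp m /rp [/hp]. Qed.

Lemma homog_int_split_quo e y (p v : S) :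
  (forall m, m \in msupp v -> (U_(y) + m)%MM \in msupp p) ->
  homog_int e p -> homog_int (e - 1) v.
Proof. by move=> vp hp m /vp /hp; rewrite mdegD mdeg1; lia. Qed.

Lemma msupp_neq0 (p r : S) : {subset msupp r <= msupp p} -> r != 0 -> p != 0.
Proof.
move=> rp; apply: contraNneq => p0; rewrite -msupp_eq0.
by case E: (msupp r) => [//|m s]; have := rp m; rewrite E p0 msupp0 inE eqxx => /(_ isT).
Qed.

Lemma var_free_sum y (I : Type) (r : seq I) (Q : pred I) (F : I -> S) :
  (forall i, Q i -> mon_ideal (fun m => m y = 0%N) (F i)) ->
  mon_ideal (fun m => m y = 0%N) (\sum_(i <- r | Q i) F i).
Proof.
move=> QF; elim/big_rec: _ => [m|i p Qi hp m]; first by rewrite msupp0.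
by move/msuppD_le; rewrite mem_cat => /orP [/(QF i Qi)|/hp].
Qed.

Lemma var_freeM y p q : mon_ideal (fun m => m y = 0%N) p ->
  mon_ideal (fun m => m y = 0%N) q -> mon_ideal (fun m => m y = 0%N) (p * q).
Proof.
move=> hp hq m /msuppM_le /allpairsP [[m1 m2] /= [/hp h1 /hq h2 ->]].
by rewrite mnmDE h1 h2.
Qed.

Lemma var_free_sgn y N (p : 'I_N) A : mon_ideal (fun m => m y = 0%N) (sgn S p A).
Proof.
move=> m /(@homog_int_sgn K n N p A) [] /eqP; rewrite mdeg_eq0 => /eqP ->.
by rewrite mnm0E.
Qed.

End MonomialIdeals.

(** * Cycles of K(I, S/J) and their splitting along dead generators *)

Section KoszulCycles.
Variables (K : fieldType) (n N : nat) (f : 'I_N -> 'X_{1..n}).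
Local Notation S := {mpoly K[n]}.
Implicit Types (J : S -> Prop) (G E A C : {set 'I_N}) (c : {set 'I_N} -> S)
  (p q r : 'I_N) (P : 'X_{1..n} -> Prop) (y : 'I_n).

Definition mono p : S := 'X_[f p].

Definition wedge_deg A : int := (\sum_(p in A) mdeg (f p))%N%:Z.

(** Generators in x_0, ..., x_(k-1) alone; the others are dead, being divisible by a variable put
    into J. *)
Definition active k : {set 'I_N} :=
  [set p | [forall l : 'I_n, (k <= l)%N ==> (f p l == 0%N)]].

(* The part of Z_T(f, S/J) spanned by the e_A with A \ G = E. *)
Definition cyc J G E T c : Prop :=
  (forall A, c A != 0 -> A :\: G = E /\ #|A| = T) /\
  forall C, J (kos mono c C).

Lemma activeP k p :
  reflect (forall l : 'I_n, (k <= l)%N -> f p l = 0%N) (p \in active k).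
Proof.
rewrite inE; apply: (iffP forallP) => [h l kl|h l].
  by have := h l; rewrite kl => /eqP.
by apply/implyP => /h ->.
Qed.

Lemma active_sub k : active k \subset active k.+1.
Proof. by apply/subsetP=> p /activeP h; apply/activeP=> l /ltnW; apply: h. Qed.

Lemma wedge_degU1 p A : p \notin A ->
  wedge_deg (p |: A) = (mdeg (f p))%:Z + wedge_deg A.
Proof. by move=> pA; rewrite /wedge_deg big_setU1. Qed.

Lemma wedge_degD1 p A : p \in A ->
  wedge_deg A = (mdeg (f p))%:Z + wedge_deg (A :\ p).
Proof. by move=> pA; rewrite -wedge_degU1 ?setD1K // !inE eqxx. Qed.

Lemma wedge_deg_le (a : int) A : (forall p, (mdeg (f p))%:Z <= a) ->
  wedge_deg A <= #|A|%:Z * a.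
Proof.
move=> fa; rewrite /wedge_deg (big_morph Posz PoszD (erefl _)).
by rewrite -[#|A|%:Z]natz mulr_natl -sumr_const; apply: ler_sum => p _.
Qed.

Lemma inactive_ideal k b P p z : stable_in k b P -> p \notin active k ->
  mon_ideal P (mono p * z).
Proof.
case=> uP vP _ _ pk; rewrite mulrC; have [_ _ iM] := is_ideal_mon K uP.
apply: iM; apply: mon_idealX; move: pk; rewrite inE negb_forall => /existsP [l].
by rewrite negb_imply => /andP [kl fl]; apply: (upward_le uP) (vP l kl); rewrite lep1mP.
Qed.

Lemma submod_cyc J G E T : is_ideal J -> submod (cyc J G E T).
Proof.
move=> iJ; have [J0 JD JM] := iJ; split.
- by split=> [A|C]; rewrite ?eqxx // /kos big1 // => p _; rewrite mulr0.
- move=> c c' [sc kc] [sc' kc']; split=> [A|C]; last by rewrite kosD; auto.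
  case: (eqVneq (c A) 0) => [->|/sc //]; rewrite add0r; exact: sc'.
- move=> z c [sc kc]; split=> [A|C]; last by rewrite kosM; auto.
  by case: (eqVneq (c A) 0) => [->|/sc //]; rewrite mulr0 eqxx.
Qed.

(** Modulo J the differential only removes indices of G, so only those coefficients decide whether c
    is a cycle at C. *)
Lemma kos_mono_congr J G c c' C : is_ideal J ->
  (forall p z, p \notin G -> J (mono p * z)) ->
  (forall p, p \notin C -> p \in G -> c (p |: C) = c' (p |: C)) ->
  J (kos mono c C) -> J (kos mono c' C).
Proof.
move=> iJ dead cc' Jc; have -> : kos mono c' C = kos mono c C -
    kos mono (fun A => c A - c' A) C by rewrite kosB; ring.
apply: idealB => //; apply: ideal_sum => // p pC; rewrite mulrAC mulrC.
case: (boolP (p \in G)) => pG; last exact: dead.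
by rewrite cc' // subrr !mulr0; case: iJ.
Qed.

Definition component G E c A : S := if A :\: G == E then c A else 0.

Lemma setDU1_in G p C : p \in G -> (p |: C) :\: G = C :\: G.
Proof.
move=> pG; apply/setP=> x; rewrite !inE.
by case: eqP => [->|//]; rewrite pG.
Qed.

Lemma setD_chain G0 G1 A : G0 \subset G1 -> A :\: G1 = (A :\: G0) :\: G1.
Proof.
by move=> G01; rewrite setDDl (setUidPr G01).
Qed.

(** The differential, modulo J, changes A only inside G0, so it preserves the difference A \ G0 and
    acts on each component separately. *)
Lemma cyc_component J G0 G1 E E0 T c : is_ideal J ->
  (forall p z, p \notin G0 -> J (mono p * z)) ->
  cyc J G1 E T c -> cyc J G0 E0 T (component G0 E0 c).
Proof.
move=> iJ dead [sc kc]; split=> [A|C].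
  by rewrite /component; case: (A :\: G0 =P E0) => [AE /sc [_] //|_]; rewrite eqxx.
case: (eqVneq (C :\: G0) E0) => CE.
  apply: (kos_mono_congr iJ dead _ (kc C)) => p pC pG.
  by rewrite /component setDU1_in // CE eqxx.
apply: (kos_mono_congr (c := fun=> 0) iJ dead) => [p pC pG|].
  by rewrite /component setDU1_in // (negbTE CE).
by rewrite /kos big1 => [|p _]; [case: iJ | rewrite mulr0].
Qed.

Lemma homv_component e G E c : homv wedge_deg e c -> homv wedge_deg e (component G E c).
Proof. by move=> hc A; rewrite /component; case: ifP => _ //; apply: homog_int0. Qed.

Lemma regk_le (T : Type) (sh : T -> int) k (U : (T -> S) -> Prop) J d d' :
  d <= d' -> regk sh k U J d -> regk sh k U J d'.
Proof. by move=> dd' h e u de; apply: h; apply: le_lt_trans de. Qed.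

Lemma regk_components J k G0 G1 E T d : is_ideal J -> G0 \subset G1 ->
  (forall p z, p \notin G0 -> J (mono p * z)) ->
  (forall E0, E0 :\: G1 = E -> regk wedge_deg k (cyc J G0 E0 T) J d) ->
  regk wedge_deg k (cyc J G1 E T) J d.
Proof.
move=> iJ G01 dead reg e u de Uu hu Ju.
have /fin_all_exists [w Hw] (E0 : {set 'I_N}) : exists w, E0 :\: G1 = E ->
    forall B, [/\ cyc J G0 E0 T (w B), homv wedge_deg (e - 1) (w B) &
      forall A, J (component G0 E0 (u B) A - kd k w B A)].
  have [E0E|/eqP ?] := eqVneq (E0 :\: G1) E; last by exists (fun _ => fun=> 0).
  have [||C A|w Hw] := reg E0 E0E e (fun B => component G0 E0 (u B)) de.
  - by move=> B; apply: cyc_component (Uu B).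
  - by move=> B; apply: homv_component.
  - rewrite /kd /component; case: (A :\: G0 == E0); first exact: Ju.
    by rewrite /kos big1 => [|l _]; [case: iJ | rewrite mulr0].
  by exists w.
(* The chains found for the various E0 have disjoint supports and are glued: the coefficient at A
   comes from E0 = A \ G0. *)
exists (fun B A => if A :\: G1 == E then w (A :\: G0) B A else 0) => B.
split=> [|A|A].
- split=> [A|C].
    case: (A :\: G1 =P E) => [AE|_]; last by rewrite eqxx.
    have [|[sw _] _ _] := Hw (A :\: G0) _ B; first by rewrite -setD_chain.
    by case/sw.
  case: (eqVneq (C :\: G1) E) => CE.
    have [|[_ kw] _ _] := Hw (C :\: G0) _ B; first by rewrite -setD_chain.
    apply: (kos_mono_congr iJ dead _ (kw C)) => p pC pG.
    by rewrite !setDU1_in // ?CE ?eqxx // (subsetP G01).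
  apply: (kos_mono_congr (c := fun=> 0) iJ dead) => [p pC pG|].
    by rewrite setDU1_in ?(negbTE CE) // (subsetP G01).
  by rewrite /kos big1 => [|p _]; [case: iJ | rewrite mulr0].
- case: eqP => AE; last exact: homog_int0.
  by have [|_ hw _] := Hw (A :\: G0) _ B; [rewrite -setD_chain | apply: hw].
case: (eqVneq (A :\: G1) E) => AE.
  have [|_ _ /(_ A)] := Hw (A :\: G0) _ B; first by rewrite -setD_chain.
  rewrite /component eqxx; congr (J (_ - _)).
  by rewrite /kd AE eqxx.
rewrite /kd (negbTE AE) [kos _ _ _]big1 => [|l _]; last by rewrite mulr0.
rewrite subr0; case: (eqVneq (u B A) 0) => [->|]; first by case: iJ.
by case: (Uu B) => su _ /su [AE']; rewrite AE' eqxx in AE.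
Qed.

End KoszulCycles.

(** * The regularity bound for strongly stable ideals *)

Section StronglyStable.
Variables (K : fieldType) (n N : nat) (f : 'I_N -> 'X_{1..n}) (a b : int).
Local Notation S := {mpoly K[n]}.
Local Notation mono := (@mono K n N f).
Local Notation wedge_deg := (wedge_deg f).
Local Notation active := (active f).
Local Notation cyc := (@cyc K n N f).
Implicit Types (J : S -> Prop) (G E A C : {set 'I_N}) (c : {set 'I_N} -> S)
  (p q r : 'I_N) (P : 'X_{1..n} -> Prop) (y : 'I_n).

Definition bound E T : int := T%:Z * (a + 1) + b - #|E|%:Z.

(** Without variables J contains all monomials of positive degree. A coefficient at e_A has degree
    above T (a + 1) + b - |E| - T a, which is at least 0 because |E| <= T, so it lies in J. *)
Lemma regk0_cyc P E T : (forall p, (mdeg (f p))%:Z <= a) -> 0 <= b ->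
  stable_in 0 b P ->
  regk wedge_deg 0 (cyc (mon_ideal P) (active 0) E T) (mon_ideal P) (bound E T).
Proof.
move=> fa b0 [uP vP _ _] e u de Uu hu _.
have iJ := is_ideal_mon K uP.
exists (fun _ => fun=> 0) => B; have [U0 _ _] := @submod_cyc K n N f _ (active 0) E T iJ.
split=> // [A|A]; first exact: homog_int0.
rewrite /kd [kos _ _ _]big1 => [|l _]; last by rewrite mulr0.
rewrite subr0 => m mB.
have uBA : u B A != 0 by apply: contraTneq mB => ->; rewrite msupp0.
have [su _] := Uu B; have [AE AT] := su A uBA.
have EA : (#|E| <= T)%N by rewrite -AE -AT; apply: subset_leq_card; apply: subsetDl.
have mdm := hu B A m mB; have := @wedge_deg_le n N f a A fa; rewrite AT => wd.
have : (0 < mdeg m)%N by move: de; rewrite -ltz_nat mdm /bound mulrDr mulr1; lia.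
rewrite lt0n mdeg_eq0 => m0.
have [l ml] : exists l, m l != 0%N.
  apply/existsP; apply: contraR m0; rewrite negb_exists => /forallP h.
  by apply/eqP/mnmP=> l; rewrite mnm0E; apply/eqP; have := h l; rewrite negbK.
by apply: (upward_le uP) (vP l (leq0n l)); rewrite lep1mP.
Qed.

(** * From k to k + 1 variables *)

Section InductionStep.
Variables (k : nat) (y : 'I_n) (P : 'X_{1..n} -> Prop).
Hypothesis yk : y = k :> nat.
Hypothesis stP : stable_in k.+1 b P.
Hypothesis fa : forall p, (mdeg (f p))%:Z <= a.
(** Strong stability of I on generators: x_i f_p / x_j is a multiple u f_r of a generator. *)
Hypothesis f_exchange : forall p (i j : 'I_n), (i < j)%N -> (0 < f p j)%N ->
  exists r u, (U_(i) + f p)%MM = (U_(j) + (u + f r))%MM.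

Local Notation G1 := (active k.+1).
Local Notation G0 := (active k).
Local Notation Psat := (saturation y P).
Local Notation J := (mon_ideal (K := K) P).
Local Notation Jsat := (mon_ideal (K := K) Psat).
Local Notation Jy := (mon_ideal (K := K) (fun m => Psat m \/ (0 < m y)%N)).

Let stPsat : stable_in k.+1 b Psat := stable_in_saturation yk stP.
Let stPy : stable_in k b (fun m => Psat m \/ (0 < m y)%N) :=
  stable_in_hyperplane yk stPsat.
Let iJ : is_ideal J. Proof. by case: stP => uP _ _ _; apply: is_ideal_mon. Qed.
Let iJsat : is_ideal Jsat.
Proof. by case: stPsat => uP _ _ _; apply: is_ideal_mon. Qed.
Let iJy : is_ideal Jy. Proof. by case: stPy => uP _ _ _; apply: is_ideal_mon. Qed.
Let JJsat z : J z -> Jsat z. Proof. by move=> Jz m /Jz; apply: saturationW. Qed.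
Let JsatJy z : Jsat z -> Jy z. Proof. by move=> Jz m /Jz; left. Qed.
Let Jyy z : Jy ('X_y * z).
Proof.
rewrite mulrC; have [_ _ JyM] := iJy; apply: JyM; apply: mon_idealX.
by right; rewrite mnm1E eqxx.
Qed.
Let nzd z : Jsat ('X_y * z) -> Jsat z.
Proof. by apply: mon_ideal_nonzerodivisor => m; apply: saturation_nonzerodivisor. Qed.

(** J and its saturation agree in degrees above b. From degree [bound E T] on, the boundary values
    of cycles have degree above b where this matters, so both ideals give the same cycles. *)
Lemma regk_saturate E T :
  regk wedge_deg k.+1 (cyc Jsat G1 E T) Jsat (bound E T) ->
  regk wedge_deg k.+1 (cyc J G1 E T) J (bound E T).
Proof.
have high e z : b < e -> homog_int e z -> Jsat z -> J z.
  move=> be hz Jz m mz; apply: (saturation_high_degree yk stP _ (Jz m mz)).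
  by rewrite hz.
apply: regk_transfer => //; first exact: submod_cyc.
- by move=> e v _ _ [sv kv]; split=> // C; apply: JJsat.
- by move=> e v _ _ Jv A; apply: JJsat.
- move=> e v de hv [sv _] Jv A.
  case: (eqVneq (v A) 0) => [->|vA]; first by case: iJ.
  have [AE AT] := sv A vA.
  have EA : (#|E| <= T)%N by rewrite -AE -AT; apply: subset_leq_card; apply: subsetDl.
  have := @wedge_deg_le n N f a A fa; rewrite AT => wd.
  apply: high (hv A) (Jv A); move: de; rewrite /bound mulrDr mulr1; lia.
move=> e v de hv [sv kv]; exists v; split=> // [|A]; last first.
  by rewrite subrr; case: iJsat.
split=> // C.
case: (boolP [exists p, [&& p \in G1, p \notin C & v (p |: C) != 0]]); last first.
  rewrite negb_exists => /forallP h; apply: ideal_sum => // p pC.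
  case: (boolP (p \in G1)) => pG.
    by have := h p; rewrite pG pC /= negbK => /eqP ->; rewrite mulr0; case: iJ.
  by rewrite mulrAC mulrC; apply: inactive_ideal stP pG.
(* As p is active, E is contained in C, and |C| = T - 1. Hence the value at C has degree at least
   |C| + a + 1 + b - |E| > b. *)
case/existsP=> p /and3P [pG pC vpC]; have [AE] := sv _ vpC.
rewrite cardsU1 pC add1n => AT; rewrite setDU1_in // in AE.
have EC : (#|E| <= #|C|)%N by rewrite -AE; apply: subset_leq_card; apply: subsetDl.
have wC := @wedge_deg_le n N f a C fa.
apply: (high (e - wedge_deg C)) (kv C).
  by have := fa p; move: de; rewrite /bound -AT intS mulrDl mul1r mulrDr mulr1; lia.
apply: homog_int_sum => q qC.
have -> : e - wedge_deg C = 0 + (mdeg (f q))%:Z + (e - wedge_deg (q |: C)).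
  by rewrite wedge_degU1 //; lia.
by apply: homog_intM => //; apply: homog_intM; [apply: homog_int_sgn | apply: homog_intX].
Qed.

(** Dividing by y a cycle with coefficients in [Jy] leaves a remainder free of y, hence in [Jsat];
    the quotient is again a cycle because y is regular modulo [Jsat]. *)
Lemma regk_restrict E T d : regk wedge_deg k (cyc Jsat G1 E T) Jy d ->
  regk wedge_deg k.+1 (cyc Jsat G1 E T) Jsat d.
Proof.
apply: (regk_nonzerodivisor yk) => //; first exact: submod_cyc.
move=> e v hv [sv kv] Jv.
have [r [v' [vE rv v'v]]] := mpoly_split_fam y v.
have Jr A : Jsat (r A).
  by move=> m mr; have [mv my] := rv A m mr; case: (Jv A m mv) => //; rewrite my.
exists v'; split.
- split=> [A v'A|C].
    apply: sv; apply: contra_neq v'A => vA0; apply/eqP; rewrite -msupp_eq0.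
    by case E0: (msupp _) => [//|m s]; have := v'v A m;
      rewrite E0 vA0 msupp0 inE eqxx => /(_ isT).
  apply: nzd; rewrite -kosM.
  rewrite (_ : (fun A => _) = fun A => v A - r A); last first.
    by extensionality A; rewrite vE addrC addKr.
  rewrite kosB. apply: (idealB iJsat) => //; exact: (ideal_kos _ _ iJsat).
- by move=> A; rewrite addrAC; apply: (homog_int_split_quo (v'v A) (hv A)).
- by move=> A; rewrite vE addrK.
Qed.

(* Wedging a lift of the contraction by e_q with the syzygy
   x_l e_q - x_y u e_r, which is x_l e_q modulo x_y, lifts x_l c. *)
Lemma cyc_lift : (forall E T, regk wedge_deg k (cyc Jy G0 E T) Jy (bound E T)) ->
  forall T E e c, cyc Jy G0 E T c -> homv wedge_deg e c ->
  bound E T + #|E :&: G1|%:Z <= e ->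
  exists c', [/\ cyc Jsat G1 (E :\: G1) T c', homv wedge_deg e c' &
                forall A, Jy (c A - c' A)].
Proof.
move=> reg T E e c; move Es: #|E :&: G1| => s.
have [uPy _ _ _] := stPy; have [Jsat0 JsatD JsatM] := iJsat; have [Jy0 JyD JyM] := iJy.
elim: s T E Es e c => [|s IH] T E Es e c cycc hc eb; last first.
  have [A0 cA0|c0] := pickP (fun A => c A != 0); last first.
    have [U0 _ _] := @submod_cyc K n N f _ G1 (E :\: G1) T iJsat.
    exists (fun=> 0); split=> // A; first exact: homog_int0.
    by have /negbFE/eqP -> := c0 A; rewrite subrr.
  have [q] : exists q, q \in E :&: G1 by apply/card_gt0P; rewrite Es.
  rewrite in_setI => /andP [qE qG1].
  case: (cycc) => sc kc; have [AE AT] := sc A0 cA0.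
  have /andP [qG0 qA0] : (q \notin G0) && (q \in A0) by move: qE; rewrite -AE in_setD.
  case: T eb cycc sc kc AT => [|T] eb cycc sc kc AT.
    by move: qA0; rewrite (cards0_eq AT) inE.
  (* The s + 1 spare degrees put e above [bound E T.+1], so c is a combination of x_0, ..., x_(k-1)
     with cycles z_l as coefficients. *)
  have [z [Uz hz Jz]] : exists x : 'I_n -> {set 'I_N} -> S,
      [/\ forall l, cyc Jy G0 E T.+1 (x l), forall l, homv wedge_deg (e - 1) (x l) &
      forall a, Jy (c a - \sum_(l < n | (l < k)%N) 'X_l * x l a)].
    apply: (regk_generation iJy (submod_cyc _ _ _ _ iJy) (reg E T.+1)) => //; lia.
  have fqy : (0 < f q y)%N.
    rewrite lt0n; apply: contra qG0 => /eqP fqy; apply/activeP=> l.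
    rewrite leq_eqVlt => /orP [/eqP kl|kl]; last by move/activeP: qG1; apply.
    by rewrite (_ : l = y) //; apply: val_inj; rewrite /= yk.
  have Eq1 : (E :\ q) :\: G1 = E :\: G1.
    by apply/setP=> x; rewrite !in_setD in_set1; case: eqP => [->|//]; rewrite qG1.
  have cE : #|E| = #|E :\ q|.+1 by rewrite (cardsD1 q) qE add1n.
  have /fin_all_exists [c' Hc'] (l : 'I_n) : exists c', (l < k)%N ->
      [/\ cyc Jsat G1 (E :\: G1) T.+1 c', homv wedge_deg e c' &
        forall A, Jy ('X_l * z l A - c' A)].
    have [lk|_] := boolP (l < k)%N; last by exists (fun=> 0).
    have [zs zk] := Uz l.
    have Eqs : #|(E :\ q) :&: G1| = s.
      by move: Es; rewrite (cardsD1 q) in_setI qE qG1 add1n setIDAC => -[].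
    (* The induction hypothesis lifts the contraction of z_l by e_q, which has one dead generator
       less. *)
    have [|||c1 [[c1s c1k] hc1 Jc1]] :=
        IH T (E :\ q) Eqs (e - 1 - (mdeg (f q))%:Z) (contract q (z l)).
    - split=> [A|C].
        rewrite /contract; case: (boolP (q \in A)) => qA; first by rewrite eqxx.
        move=> h; have [|AE' AT'] := zs (q |: A).
          by apply: contraNneq h => ->; rewrite mulr0.
        split; last by move: AT'; rewrite cardsU1 qA => -[].
        apply/setP=> x; have /setP/(_ x) := AE'; rewrite !in_setD in_setU1 in_set1.
        by case: (eqVneq x q) => [->|_] //=; rewrite (negbTE qA) andbF.
      rewrite kos_contract; case: ifP => _ //.
      by apply: (idealN iJy); apply: JyM.
    - move=> A; rewrite /contract; case: (boolP (q \in A)) => qA; first exact: homog_int0.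
      rewrite -[e - 1 - _ - _]add0r; apply: homog_intM; first exact: homog_int_sgn.
      by have := hz l (q |: A); rewrite wedge_degU1 // opprD addrA.
    (* Removing e_q lowers the bound by a, which covers deg f_q; the drop of s by one covers the
       factor x_l. *)
    - move: eb (fa q); rewrite /bound cE intS mulrDl mul1r; lia.
    have [|r [u fE]] := f_exchange (p := q) (i := l) (j := y) _ fqy; first by rewrite yk.
    have rG1 : r \in G1.
      apply/activeP=> l' kl'; have /activeP/(_ l' kl') fq := qG1.
      have := congr1 (fun m : 'X_{1..n} => m l') fE.
      rewrite !mnmDE fq !mnm1E; case: eqP => [ll'|_]; last lia.
      by rewrite -ll' in kl'; lia.
    (* The lift is the product of x_l e_q - y u e_r with [c1]; both q and r are in [G1], so it stays
       in the component of E \ G1. *)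
    exists (fun A => 'X_l * wedge q c1 A - 'X_y * ('X_[u] * wedge r c1 A)) => _.
    split.
    - split=> [A h|C].
        have [p pG /andP [pA c1A]] : exists2 p, p \in G1 & (p \in A) && (c1 (A :\ p) != 0).
          have [h1|h1] := eqVneq (wedge q c1 A) 0; last first.
            exists q => //; move: h1; rewrite /wedge; case: (q \in A); last by rewrite eqxx.
            by apply: contraNneq => ->; rewrite mulr0.
          exists r => //; move: h; rewrite h1 mulr0 add0r /wedge.
          case: (r \in A); last by rewrite !mulr0 oppr0 eqxx.
          by apply: contraNneq => ->; rewrite !mulr0 oppr0.
        have [AE' AT'] := c1s _ c1A; rewrite -Eq1 -AE' (cardsD1 p) pA AT'; split=> //.
        by rewrite -[in LHS](setD1K pA) setDU1_in.
      rewrite kosB !kosM !kos_wedge.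
      (* By the Leibniz rule the coefficient of [c1] is x_l f_q - y u f_r = 0, and the other terms
         contain the differential of [c1], which is in [Jsat]. *)
      have -> : 'X_l * (mono q * c1 C - wedge q (kos mono c1) C) -
          'X_y * ('X_[u] * (mono r * c1 C - wedge r (kos mono c1) C)) =
          ('X_l * mono q - 'X_y * ('X_[u] * mono r)) * c1 C
          + 'X_y * 'X_[u] * wedge r (kos mono c1) C - 'X_l * wedge q (kos mono c1) C.
        by ring.
      rewrite /mono -!mpolyXD fE subrr mul0r add0r.
      have Jw p : Jsat (wedge p (kos mono c1) C).
        by rewrite /wedge; case: ifP => _ //; apply: JsatM.
      by apply: (idealB iJsat) => //; apply: JsatM.
    - have dE : 1 + (mdeg (f q))%:Z = 1 + ((mdeg u)%:Z + (mdeg (f r))%:Z).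
        by have := congr1 (@mdeg n) fE; rewrite !mdegD !mdeg1; lia.
      have hw p A : homog_int (e - 1 - (mdeg (f q))%:Z + (mdeg (f p))%:Z - wedge_deg A)
          (wedge p c1 A).
        rewrite /wedge; case: (boolP (p \in A)) => pA; last exact: homog_int0.
        rewrite (wedge_degD1 f pA) -[X in homog_int X]add0r.
        apply: homog_intM; first exact: homog_int_sgn.
        by have := hc1 (A :\ p); congr homog_int; lia.
      move=> A; apply: homog_intB.
        have -> : e - wedge_deg A = (mdeg U_(l))%:Z +
          (e - 1 - (mdeg (f q))%:Z + (mdeg (f q))%:Z - wedge_deg A) by rewrite mdeg1; lia.
        by apply: homog_intM; [apply: homog_intX | apply: hw].
      have -> : e - wedge_deg A = (mdeg U_(y))%:Z + ((mdeg u)%:Z +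
        (e - 1 - (mdeg (f q))%:Z + (mdeg (f r))%:Z - wedge_deg A)) by rewrite mdeg1; lia.
      by do 2!(apply: homog_intM; first exact: homog_intX); apply: hw.
    move=> A; rewrite -(@wedge_contract _ _ q (z l)); last first.
      by case/zs => /setP/(_ q); rewrite qE in_setD => /andP [].
    have -> : 'X_l * wedge q (contract q (z l)) A -
        ('X_l * wedge q c1 A - 'X_y * ('X_[u] * wedge r c1 A)) =
        'X_l * (wedge q (contract q (z l)) A - wedge q c1 A)
        + 'X_y * ('X_[u] * wedge r c1 A) by ring.
    apply: JyD => //; apply: (JyM); rewrite /wedge; case: ifP => _; last by rewrite subrr.
    by rewrite -mulrBr; apply: JyM.
  exists (fun A => \sum_(l < n | (l < k)%N) c' l A); split=> [|A|A].
  - by apply: submod_sum => [|l /Hc' []//]; apply: submod_cyc.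
  - by apply: homog_int_sum => l /Hc' [].
  have -> : c A - \sum_(l < n | (l < k)%N) c' l A =
      (c A - \sum_(l < n | (l < k)%N) 'X_l * z l A) +
      \sum_(l < n | (l < k)%N) ('X_l * z l A - c' l A) by rewrite sumrB; ring.
  by apply: JyD => //; apply: ideal_sum => // l /Hc' [].
(* Base case: no generator of E is revived by y. The part of c free of y is then already a cycle
   modulo [Jsat]. *)
have EG1 q : q \in E -> q \notin G1.
  move=> qE; apply/negP=> qG; have : q \in E :&: G1 by rewrite in_setI qE.
  by rewrite (cards0_eq Es) inE.
have [r [v [cE rc vc]]] := mpoly_split_fam y c.
have [sc kc] := cycc.
have sr A : r A != 0 -> A :\: G0 = E /\ #|A| = T.
  by move=> rA; apply: sc; apply: msupp_neq0 rA => m /rc [].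
exists r; split=> [|A|A]; last 2 first.
- exact: (homog_int_split_rem (rc A) (hc A)).
- by rewrite cE addrC addKr.
split=> [A /sr [AE ->]|C]; first by rewrite -AE -setD_chain // active_sub.
have Jyr : Jy (kos mono r C).
  have -> : kos mono r C = kos mono c C - kos mono (fun A => c A - r A) C.
    by rewrite kosB; ring.
  by apply: (idealB iJy) => //; apply: (ideal_kos _ _ iJy) => A; rewrite cE addrC addKr.
(* Generators outside [G1] vanish modulo [Jsat], and those in [G1] but not [G0] would belong to E;
   only R remains. It is free of y and in [Jy], hence in [Jsat]. *)
pose R := \sum_(p | (p \notin C) && (p \in G0)) sgn S p C * mono p * r (p |: C).
have JR : Jsat (kos mono r C - R).
  rewrite /kos (bigID (mem G0)) /= -/R [R + _]addrC addrK.
  apply: ideal_sum => // p /andP [pC pG0].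
  case: (boolP (p \in G1)) => pG1; last first.
    by rewrite mulrAC mulrC; apply: inactive_ideal stPsat pG1.
  case: (eqVneq (r (p |: C)) 0) => [->|/sr [pE _]]; first by rewrite mulr0.
  by have := EG1 p; rewrite -pE in_setD setU11 pG0 pG1 => /(_ isT).
suff JsatR : Jsat R by rewrite -(subrK R (kos mono r C)); apply: JsatD.
have JyR : Jy R by rewrite -(subKr (kos mono r C) R); apply: (idealB iJy) => //; apply: JsatJy.
have Ry : mon_ideal (fun m => m y = 0%N) R.
  apply: var_free_sum => p /andP [_ /activeP pG]; apply: var_freeM.
    by apply: var_freeM; [apply: var_free_sgn | apply: mon_idealX; rewrite pG ?yk].
  by move=> m /rc [].
by move=> m mR; case: (JyR m mR) => //; rewrite (Ry m mR).
Qed.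

(** Modulo y, the cycles over [Jsat] are compared with those over [Jy]: one inclusion is clear, and
    [cyc_lift] on each component gives the other from degree [bound E T] on. *)
Lemma regk_succ : (forall E T, regk wedge_deg k (cyc Jy G0 E T) Jy (bound E T)) ->
  forall E T, regk wedge_deg k.+1 (cyc J G1 E T) J (bound E T).
Proof.
move=> reg E T; apply: regk_saturate; apply: regk_restrict.
have inactJy p z : p \notin G0 -> Jy (mono p * z).
  by move=> pG; apply: inactive_ideal stPy pG.
(* This makes [bound E0 T] plus |E0 meet G1|, the threshold for lifting, equal to [bound E T]. *)
have cardE E0 : E0 :\: G1 = E -> #|E0|%:Z = #|E0 :&: G1|%:Z + #|E|%:Z.
  by move=> <-; rewrite -PoszD cardsID.
apply: (@regk_transfer K n _ wedge_deg k _ _ (cyc Jy G1 E T) Jy) => //.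
- exact: submod_cyc.
- by move=> e v _ _ [sv kv]; split=> // C; apply: JsatJy.
- move=> e v de hv [sv kv].
  have /fin_all_exists [w Hw] (E0 : {set 'I_N}) : exists w, E0 :\: G1 = E ->
      [/\ cyc Jsat G1 E T w, homv wedge_deg e w &
        forall A, Jy (component G0 E0 v A - w A)].
    have [E0E|/eqP ?] := eqVneq (E0 :\: G1) E; last by exists (fun=> 0).
    have [|||w] := cyc_lift reg (T := T) (E := E0) (e := e) (c := component G0 E0 v).
    - by have /(cyc_component E0 iJy inactJy) : cyc Jy G1 E T v by split.
    - exact: homv_component.
    - by move: de (cardE E0 E0E); rewrite /bound; lia.
    by rewrite E0E; exists w.
  exists (fun A => \sum_(E0 | E0 :\: G1 == E) w E0 A); split=> [|A|A].
  + by apply: submod_sum => [|E0 /eqP /Hw []//]; apply: submod_cyc.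
  + by apply: homog_int_sum => E0 /eqP /Hw [].
  have -> : v A = \sum_(E0 | E0 :\: G1 == E) component G0 E0 v A.
    case: (eqVneq (v A) 0) => [vA|/sv [AE _]].
      by rewrite big1 => [|E0 _] //; rewrite /component vA if_same.
    rewrite (bigD1 (A :\: G0)) /=; last by rewrite -setD_chain ?active_sub ?AE.
    rewrite [component _ _ _ _]/component eqxx big1 ?addr0 // => E0 /andP [_ E0A].
    by rewrite /component eq_sym (negbTE E0A).
  by rewrite -sumrB; apply: ideal_sum => // E0 /eqP /Hw [].
apply: (regk_components iJy (active_sub f k) inactJy) => E0 E0E.
by apply: regk_le (reg E0 T); have := cardE E0 E0E; rewrite /bound; lia.
Qed.

End InductionStep.

Lemma regk_cyc k P : (k <= n)%N -> 0 <= b -> stable_in k b P ->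
  (forall p, (mdeg (f p))%:Z <= a) ->
  (forall p (i j : 'I_n), (i < j)%N -> (0 < f p j)%N ->
     exists r u, (U_(i) + f p)%MM = (U_(j) + (u + f r))%MM) ->
  forall E T, regk wedge_deg k (cyc (mon_ideal P) (active k) E T) (mon_ideal P) (bound E T).
Proof.
(* P varies in the induction: one variable less means saturating by y and then adding y. *)
move=> kn b0 stP fa fex; elim: k kn P stP => [|k IH] kn P stP E T; first exact: regk0_cyc.
apply: (@regk_succ k (Ordinal kn)) => // E0 T0; apply: IH; first exact: ltnW.
by apply: stable_in_hyperplane => //; apply: stable_in_saturation.
Qed.

End StronglyStable.

(** * Monomials of Borel-fixed ideals, and degrees of generators bounded by regularity *)

Section BorelFixed.
Variables (K : fieldType) (n : nat).
Local Notation S := {mpoly K[n]}.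
Implicit Types (I J : S -> Prop) (m g : 'X_{1..n}).

Definition monomials_of I m : Prop := I 'X_[m].

Definition minimal_monomial I g : Prop :=
  I 'X_[g] /\ forall m, I 'X_[m] -> mdivides m g -> m = g.

Lemma upward_monomials_of I : is_ideal I -> upward (monomials_of I).
Proof. by case=> _ _ IM m m' Im; rewrite /monomials_of mpolyXD mulrC; apply: IM. Qed.

Lemma monomial_idealP I p : monomial_ideal I -> I p <-> mon_ideal (monomials_of I) p.
Proof.
case=> iI mI; have uI := upward_monomials_of iI; split=> [/mI [s [sI ->]]|Ip].
  rewrite big_seq; apply: (ideal_sum _ (is_ideal_mon K uI)) => x xs.
  have [_ _ IM] := is_ideal_mon K uI; apply: IM; apply: mon_idealX; exact: sI.
rewrite [p]mpolyE big_seq; apply: (ideal_sum _ iI) => m mp.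
by rewrite -mul_mpolyC; case: iI => _ _; apply; apply: Ip.
Qed.

Lemma minimal_monomial_below I m : I 'X_[m] ->
  exists2 g, minimal_monomial I g & (g <= m)%MM.
Proof.
move: {2}(mdeg m).+1 (ltnSn (mdeg m)) => d; elim: d m => // d IH m md Im.
have [[m' [Im' m'm nm]]|nex] :=
    classic (exists m', [/\ I 'X_[m'], (m' <= m)%MM & m' <> m]).
  have E := submK m'm; have := congr1 (@mdeg n) E; rewrite mdegD => dE.
  have : mdeg (m - m')%MM != 0%N.
    by rewrite mdeg_eq0; apply/eqP => m0; apply: nm; rewrite -E m0 add0m.
  move=> d0; have [|g mg gm'] := IH m' _ Im'; first by lia.
  by exists g; last exact: lepm_trans gm' m'm.
exists m; last exact: lepm_refl; split=> // m' Im' /mnm_lepP m'm.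
by case: (eqVneq m' m) => // /eqP nm; case: nex; exists m'.
Qed.

(** The elementary matrix sending x_j to x_j + x_i maps the monomial into I; with e the exponent of
    x_j in m, the term in x_i x_j^e has coefficient e + 1, nonzero in characteristic 0. *)
Lemma borel_fixed_exchange I m (i j : 'I_n) : [pchar K] =i pred0 -> borel_fixed I ->
  (i < j)%N -> I 'X_[U_(j) + m] -> I 'X_[U_(i) + m].
Proof.
move=> ch0 [mI bI] ij Im; have ij' : i != j by rewrite -val_eqE /= neq_ltn ij.
pose A : 'M[K]_n := 1%:M + delta_mx i j.
have Aunit : A \in unitmx.
  have : A *m (1%:M - delta_mx i j) = 1%:M.
    rewrite mulmxDl mul1mx mulmxBr mulmx1 mul_delta_mx_0 ?[j == i]eq_sym //.
    by rewrite subr0 subrK.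
  by case/mulmx1_unit.
have Atri : upper_triangular A.
  move=> r c cr; rewrite !mxE -[r == c]val_eqE /= gtn_eqF // add0r.
  case: (eqVneq r i) => [ri|//]; case: (eqVneq c j) => [cj|//].
  by move: cr; rewrite ri cj ltnNge ltnW.
have [/(_ _ Im) + _] := bI A Aunit Atri.
pose m' := [multinom (if c == j then 0 else m c)%N | c < n].
have mE : m = (U_(j) *+ m j + m')%MM.
  apply/mnmP=> c; rewrite mnmDE mulmnE mnm1E mnmE [c == j]eq_sym.
  by case: eqP => [<-|]; rewrite ?mul1n ?addn0.
have colE c : \sum_(r < n) A r c *: 'X_r = 'X_c + (if c == j then 'X_i else 0) :> S.
  under eq_bigr => r _ do rewrite !mxE scalerDl.
  rewrite big_split /= (bigD1 c) //= eqxx scale1r big1 ?addr0; last first.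
    by move=> r /negbTE ->; rewrite scale0r.
  rewrite (bigD1 i) //= eqxx big1 ?addr0; last first.
    by move=> r /negbTE ->; rewrite scale0r.
  by case: eqP => _; rewrite ?scale1r ?scale0r.
have -> : mat_act A 'X_[U_(j) + m] = ('X_j + 'X_i) ^+ (m j).+1 * 'X_[m'].
  rewrite /mat_act comp_mpolyX (bigD1 j) //= tnth_mktuple colE eqxx.
  rewrite mnmDE mnm1E eqxx add1n (mpolyXE_id _ m') [in RHS](bigD1 j) //=; congr (_ * _).
  rewrite [m' j]mnmE eqxx expr0 mul1r; apply: eq_bigr => c cj.
  by rewrite tnth_mktuple colE (negbTE cj) addr0 mnmDE mnm1E [m' c]mnmE [j == c]eq_sym
    (negbTE cj).
move/(monomial_idealP _ mI); apply.
have -> : (U_(i) + m)%MM = (m' + (U_(i) + U_(j) *+ m j))%MM.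
  by rewrite {1}mE addmA addmC.
rewrite mcoeff_msupp mcoeffMX.
rewrite exprDn raddf_sum /= (bigD1 (inord 1)) //= big1 ?addr0; last first.
  move=> r r1; rewrite mcoeffMn !mpolyXn -mpolyXD mcoeffX.
  case: eqP => [/mnmP/(_ i)|_]; last by rewrite mul0rn.
  rewrite !(mnmDE, mulmnE, mnm1E) eqxx [j == i]eq_sym (negbTE ij') mul0n mul1n addn0.
  by move=> r1'; case/eqP: r1; apply: val_inj; rewrite /= inordK.
rewrite inordK // mcoeffMn !mpolyXn -mpolyXD mcoeffX subn1 mulm1n addmC eqxx bin1.
by move/pcharf0P: ch0 => ->.
Qed.

(** Every monomial of (x_0, ..., x_(n-1)) I has a proper divisor in I, which a minimal generator has
    not. *)
Lemma minimal_monomial_sum I g (Q : pred 'I_n) (s z : 'I_n -> S) : monomial_ideal I ->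
  minimal_monomial I g -> (forall l, Q l -> I (z l)) ->
  'X_[g] <> \sum_(l | Q l) s l * 'X_l * z l.
Proof.
move=> mI [Ig gmin] Iz gE; have uI := upward_monomials_of (proj1 mI).
pose P m := exists l m', monomials_of I m' /\ m = (U_(l) + m')%MM.
have uP : upward P.
  by move=> m1 m2 [l [m' [Im' ->]]]; exists l, (m' + m2)%MM; rewrite addmA; split; auto.
have : mon_ideal P ('X_[g] : S).
  rewrite gE; apply: (ideal_sum _ (is_ideal_mon K uP)) => l Ql.
  have [_ _ PM] := is_ideal_mon K uP; rewrite -mulrA; apply: PM.
  move=> m /msuppM_le /allpairsP [[m1 m2] /=]; rewrite msuppX inE.
  case=> /eqP -> m2z ->; exists l, m2; split=> //.
  by move/(monomial_idealP _ mI): (Iz l Ql); apply.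
have gg : g \in msupp ('X_[g] : S) by rewrite msuppX inE.
move=> /(_ g gg) [l [m' [Im' gE']]]; have := gmin m' Im'.
have m'g : mdivides m' g by move=> c; rewrite gE' mnmDE leq_addl.
move=> /(_ m'g) m'E; have := congr1 (@mdeg n) gE'; rewrite m'E mdegD mdeg1; lia.
Qed.

(** The generator g gives a nonzero class in Tor_0(I, K), in degree deg g. *)
Lemma reg_ideal_mod_gen I (a : int) g : monomial_ideal I -> reg_le (ideal_mod I) a ->
  minimal_monomial I g -> (mdeg g)%:Z <= a.
Proof.
move=> mI rI mg; have := rI 0%N (mdeg g)%:Z; rewrite subr0; apply.
exists (fun _ _ => 'X_[g]); split=> [B _|].
  split=> /=; first by case: mg.
  by move=> l; rewrite !subr0; apply: homog_intX.
split=> // -[w [Uw Ww]]; have /= := Ww set0 (cards0 _).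
move/eqP; rewrite subr_eq0 => /eqP.
apply: (minimal_monomial_sum mI mg) => l _.
by case: (Uw (l |: set0)); rewrite ?setU0 ?cards1.
Qed.

(** As g is not 1, some x_l divides it, and (g / x_l) e_l is a cycle giving a nonzero class in
    Tor_1(S/J, K), in degree deg g. *)
Lemma reg_quot_mod_gen J (b : int) g : monomial_ideal J -> reg_le (quot_mod J) b ->
  ~ J 1 -> minimal_monomial J g -> (mdeg g)%:Z <= b + 1.
Proof.
move=> mJ rJ J1 mg; have [Jg _] := mg; have [_ JD JM] := proj1 mJ.
have [l gl] : exists l, g l != 0%N.
  apply/existsP; apply: contra_notT J1; rewrite negb_exists => /forallP h.
  rewrite -mpolyX0 (_ : 0%MM = g) //; apply/mnmP=> l; rewrite mnm0E.
  by apply/esym/eqP; have := h l; rewrite negbK.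
have lg : (U_(l) <= g)%MM by rewrite lep1mP.
have gE : 'X_[g] = 'X_l * 'X_[g - U_(l)] :> S by rewrite -mpolyXD addmC submK.
suff : (mdeg g)%:Z - 1 <= b by lia.
apply: (rJ 1%N); exists (fun B _ => if B == [set l] then 'X_[g - U_(l)] else 0).
have termE (C : {set 'I_n}) l' : l' \notin C -> l' |: C = [set l] -> l' = l.
  by move=> _ /setP/(_ l'); rewrite setU11 inE => /esym/eqP.
split=> [B _|].
  split=> // -[]; rewrite subr0; case: ifP => _; last exact: homog_int0.
  have := congr1 (@mdeg n) (submK lg); rewrite mdegD mdeg1 => dE.
  by rewrite -dE PoszD addrK; apply: homog_intX.
split=> [C _|[w [_ Ww]]].
  apply: (ideal_sum _ (proj1 mJ)) => l' l'C; case: eqP => [/(termE C l' l'C) ->|_].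
    by rewrite -mulrA -gE; apply: JM.
  by rewrite mulr0; case: (proj1 mJ).
pose u (B : {set 'I_n}) : S := if B == [set l] then 'X_[g - U_(l)] else 0.
(* If the class vanished, v would have coefficients in J on singletons, and its differential, which
   is g, would lie in (x_0, ..., x_(n-1)) J. *)
pose v (B : {set 'I_n}) : S := u B - kos (fun l => 'X_l) (fun B => w B tt) B.
apply: (minimal_monomial_sum (Q := fun l => l \notin set0) (s := fun l => sgn S l set0 * 1)
  (z := fun l => v (l |: set0)) mJ mg) => [l' _|].
  by have := Ww (l' |: set0); rewrite setU0 cards1 => /(_ erefl).
transitivity (kos (fun l => 'X_l) v set0); last first.
  by apply: eq_bigr => l' _; rewrite mulr1.
rewrite kosB kos_kos subr0 /kos (bigD1 l) ?inE //= big1 ?addr0; last first.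
  move=> l' /andP [l'0 l'l]; rewrite /u; case: eqP => [/(termE _ _ l'0)|];
    last by rewrite mulr0.
  by move=> E; rewrite E eqxx in l'l.
rewrite /u setU0 eqxx gE /sgn (_ : [set q in set0 | _] = set0) ?cards0 ?mul1r //.
by apply/setP=> q; rewrite !inE.
Qed.

Lemma reg_quot_mod_ge0 J (b : int) : is_ideal J -> reg_le (quot_mod J) b ->
  ~ J 1 -> 0 <= b.
Proof.
move=> iJ rJ J1; rewrite -[0](subr0 0); apply: (rJ 0%N 0).
exists (fun _ _ => 1); split=> [B _|].
  by split=> // -[]; rewrite !subr0; apply: homog_int1.
split=> // -[w [Uw Ww]]; apply: J1; have /= := Ww set0 (cards0 _).
(* The chain [w] has degree -1 and is therefore zero. *)
suff -> : kdiff (M := quot_mod J) w set0 tt = 0 by rewrite subr0.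
apply: big1 => l _; rewrite (_ : w _ tt = 0) ?mulr0 //.
have [|_ /(_ tt) /= hw] := Uw (l |: set0); first by rewrite setU0 cards1.
apply: msuppnil0; case E: (msupp _) => [//|m s].
by have := hw m; rewrite E inE eqxx => /(_ isT).
Qed.

End BorelFixed.

(** * The bound for Borel-fixed ideals *)

Lemma stable_in_borel_fixed (K : fieldType) (n : nat) (J : {mpoly K[n]} -> Prop) (b : int) :
  [pchar K] =i pred0 -> borel_fixed J -> reg_le (quot_mod J) b -> ~ J 1 ->
  stable_in n b (monomials_of J).
Proof.
move=> ch0 bJ rJ J1; have [mJ _] := bJ; split.
- by apply: upward_monomials_of; case: mJ.
- by move=> l; rewrite leqNgt ltn_ord.
- by move=> m i j ij _; apply: borel_fixed_exchange.
move=> m Jm _; have [g mg gm] := minimal_monomial_below Jm.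
by exists g; split=> //; [case: mg | apply: (reg_quot_mod_gen mJ rJ J1)].
Qed.

(** Since x_i f_p / x_j lies in I, a minimal generator f_r divides it, with cofactor u. *)
Lemma min_gens_exchange (K : fieldType) (n : nat) (I : {mpoly K[n]} -> Prop)
    (gs : seq 'X_{1..n}) : [pchar K] =i pred0 -> borel_fixed I -> min_monomial_gens I gs ->
  forall (p : 'I_(size gs)) (i j : 'I_n), (i < j)%N -> (0 < nth 0%MM gs p j)%N ->
  exists (r : 'I_(size gs)) u,
    (U_(i) + nth 0%MM gs p)%MM = (U_(j) + (u + nth 0%MM gs r))%MM.
Proof.
move=> ch0 bI [_ gsE] p i j ij; set g := nth _ _ _; rewrite lt0n => gj.
have jg : (U_(j) <= g)%MM by rewrite lep1mP.
have Ig : I 'X_[g] by have /gsE[] : g \in gs by rewrite mem_nth.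
have [h mh hle] : exists2 h, minimal_monomial I h & (h <= U_(i) + (g - U_(j)))%MM.
  apply: minimal_monomial_below; apply: (borel_fixed_exchange ch0 bI ij).
  by rewrite addmC submK.
have hgs : h \in gs by apply/gsE.
have hs : (index h gs < size gs)%N by rewrite index_mem.
exists (Ordinal hs), (U_(i) + (g - U_(j)) - h)%MM.
by rewrite /= nth_index // submK // [RHS]addmC -addmA submK.
Qed.

Theorem theorem4p4 (K : fieldType) (n : nat) (I J : {mpoly K[n]} -> Prop)
  (gs : seq 'X_{1..n}) (t : nat) :
  [pchar K] =i pred0 ->
  borel_fixed I -> borel_fixed J -> min_monomial_gens I gs ->
  forall a b : int, reg_le (ideal_mod I) a -> reg_le (quot_mod J) b ->
  reg_le (cycles_mod gs J t) (t%:Z * (a + 1) + b).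
Proof.
move=> ch0 bI bJ mgs a b rI rJ i j [u [Uu [Ju nu]]].
have [mI _] := bI; have [mJ _] := bJ; have [iJ _] := mJ.
have [J0 _ JM] := iJ.
have kos0 N (g : 'I_N -> {mpoly K[n]}) C : kos g (fun=> 0) C = 0.
  by rewrite /kos big1 // => p _; rewrite mulr0.
(* If J = S, the cycle module is zero and every chain is bounded by 0. *)
have [J1|J1] := classic (J 1).
  case: nu; exists (fun _ _ => 0); split=> [B _|B _ A].
    split; last by move=> A; apply: homog_int0.
    by split=> // C _; rewrite -[X in J X]mulr1; apply: JM.
  by rewrite -[X in J X]mulr1; apply: JM.
rewrite leNgt; apply/negP=> lt_ij; case: nu.
pose f (p : 'I_(size gs)) := nth 0%MM gs p.
have fa p : (mdeg (f p))%:Z <= a.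
  apply: (reg_ideal_mod_gen mI rI); have [_ gsE] := mgs.
  by apply/gsE; rewrite mem_nth.
(* With all n variables no generator is dead, so E = [set0] gives the whole of Z_t. *)
have activeT : active f n = setT.
  by apply/setP=> p; rewrite in_setT; apply/activeP=> l; rewrite leqNgt ltn_ord.
have JP p := monomial_idealP p mJ.
have := @regk_cyc K n _ f a b n _ (leqnn n) (reg_quot_mod_ge0 iJ rJ J1)
  (stable_in_borel_fixed ch0 bJ rJ J1) fa (min_gens_exchange ch0 bI mgs) set0 t.
rewrite activeT /bound cards0 subr0.
have kdE v C A : kd n v C A = kdiff (M := cycles_mod gs J t) v C A.
  by apply: eq_bigr => l _; rewrite /kvar ltn_ord.
(* [regk] treats all homological positions at once, so u is extended by zero outside position i. *)
move=> /(_ (j - i%:Z) (fun B A => if #|B| == i then u B A else 0)) [] //.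
- move=> B; case: (eqVneq #|B| i) => [/Uu [[su ku] _]|_]; last first.
    by have [] := @submod_cyc K n _ f _ setT set0 t (is_ideal_mon K (upward_monomials_of iJ)).
  split=> [A uA|C].
    by rewrite setDT; split=> //; apply/eqP; apply: contraNT uA => /eqP /su ->.
  apply/JP; case: (eqVneq #|C|.+1 t) => [/ku //|Ct].
  rewrite [kos _ _ _]big1 // => p pC; rewrite su ?mulr0 // cardsU1 pC add1n.
  exact/eqP.
- move=> B A; case: (eqVneq #|B| i) => [/Uu [_ hu]|_]; [exact: hu | exact: homog_int0].
- move=> C A; apply/JP; case: (eqVneq #|C|.+1 i) => [Ci|Ci].
    have -> : kd n (fun B A => if #|B| == i then u B A else 0) C A =
        kdiff (M := cycles_mod gs J t) u C A; last exact: Ju.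
    rewrite kdE; apply: eq_bigr => l lC.
    by rewrite cardsU1 lC add1n Ci eqxx.
  rewrite [kd _ _ _ _]big1 // => l lC.
  by rewrite cardsU1 lC add1n (negbTE Ci) mulr0.
move=> w Hw; exists w; split=> [B _|B Bi A]; have [[sw kw] hw Jw] := Hw B.
  split; last by have -> : j - i.+1%:Z = j - i%:Z - 1 by lia.
  split=> [A At|C _]; last exact/JP/kw.
  by apply/eqP; apply: contra_notT At => /sw [].
by rewrite -kdE; apply/JP; have := Jw A; rewrite Bi eqxx.
Qed.
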